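(* Let $U$ and $V$ be theories in the same signature $\mathcal{L}$ such that $U$ is $\tau$-$\mathsf{R}_{0\mathsf{p}}$-sourced and $V$ is $\tau'$-$\mathsf{R}_{0\mathsf{p}}$-sourced, where the restrictions of the translations $\tau$ and $\tau'$ to the arithmetical signature $\mathbb{L}_{\sf a}$ coincide. Then $U\cup V$ is $\mathsf{R}_{0\mathsf{p}}$-sourced.
   Context: $\mathbb{L}_{\sf a}=\{0,\mathsf{S},+,\times,\leq\}$ with $\leq$ primitive; $\mathbb{L}_{\sf ap}$ is $\mathbb{L}_{\sf a}$ plus a unary predicate $\mathsf{P}$; $\mathfrak{id}_{\sf ap}$ are the identity axioms of $\mathbb{L}_{\sf ap}$. $\mathsf{R}_0$ is the $\mathbb{L}_{\sf a}$-theory with axioms, for all $m,n\in\omega$: $\overline{m}+\overline{n}=\overline{m+n}$; $\overline{m}\times\overline{n}=\overline{m\times n}$; $\overline{m}\neq\overline{n}$ if $m\neq n$; $\forall x\,(x\leq\overline{n}\to\bigvee_{i\leq n}x=\overline{i})$; $\overline{m}\leq\overline{n}$ if $m\leq n$ ($\overline{n}$ numerals). $\mathsf{R}_{0\mathsf{p}}$ is $\mathsf{R}_0$ plus $\mathsf{P}(\overline{n})$ for all $n$. A translation from signature $\Theta$ to $\Xi$ gives a domain formula and, for each relation symbol (identity included; function symbols via graphs), a $\Xi$-formula, extended to all formulas by commuting with connectives and relativizing quantifiers. A c.e. theory $W$ is $\tau$-$\mathsf{R}_{0\mathsf{p}}$-sourced iff $W$ is deductively equivalent to $(\mathsf{R}_{0\mathsf{p}}+\mathfrak{id}_{\sf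 ap})^\tau$; it is $\mathsf{R}_{0\mathsf{p}}$-sourced iff it is $\tau$-$\mathsf{R}_{0\mathsf{p}}$-sourced for some $\tau$. $U\cup V$ is the theory axiomatized by the union of the axioms of $U$ and $V$. *)

(* Defs.v *)
From HB Require Import structures.
From mathcomp Require Import all_boot.

Set Implicit Arguments.
Unset Strict Implicit.
Unset Printing Implicit Defensive.

(* Identity is not listed: it belongs to every signature.  Countability of the
   symbol types serves only to number formulas.                               *)
Record signature := Signature {
  fsym : countType;
  rsym : countType;
  far : fsym -> nat;
  rar : rsym -> nat }.

(* De Bruijn indices, not bounded by the type. *)
Inductive term (L : signature) :=
  | Var of nat
  | App (f : fsym L) of {ffun 'I_(far f) -> term L}.

Arguments Var {L} n.

Inductive form (L : signature) :=
  | Bot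
  | Eq of term L & term L
  | Rel (r : rsym L) of {ffun 'I_(rar r) -> term L}
  | Imp of form L & form L
  | And of form L & form L
  | Or of form L & form L
  | All of form L
  | Ex of form L.

Arguments Bot {L}.

Lemma term_ind_ffun (L : signature) (P : term L -> Prop) :
  (forall n, P (Var n)) ->
  (forall f (ts : {ffun 'I_(far f) -> term L}),
     (forall i, P (ts i)) -> P (App ts)) ->
  forall t, P t.
Proof.
move=> Pv Pf; fix IH 1; case=> [n|f ts]; first exact: Pv.
by apply: Pf => i; apply: IH.
Qed.

Section Syntax.
Variable L : signature.
Implicit Types (t : term L) (p : form L).

Definition Neg p := Imp p Bot.

Definition Alls n p := iter n (@All L) p.

Definition BigOr (ps : seq (form L)) := foldr (@Or L) Bot ps.

Fixpoint subst_term (s : nat -> term L) t : term L :=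
  match t with
  | Var n => s n
  | App f ts => App [ffun i => subst_term s (ts i)]
  end.

Definition up (s : nat -> term L) (n : nat) : term L :=
  if n is m.+1 then subst_term (fun k => Var k.+1) (s m) else Var 0.

Fixpoint subst (s : nat -> term L) p : form L :=
  match p with
  | Bot => Bot
  | Eq t u => Eq (subst_term s t) (subst_term s u)
  | Rel r ts => Rel [ffun i => subst_term s (ts i)]
  | Imp p q => Imp (subst s p) (subst s q)
  | And p q => And (subst s p) (subst s q)
  | Or p q => Or (subst s p) (subst s q)
  | All p => All (subst (up s) p)
  | Ex p => Ex (subst (up s) p)
  end.

Definition shift p := subst (fun n => Var n.+1) p.

(* p[t/0]: the variable 0 is replaced by t, the others are lowered by one. *)
Definition subst1 p t := subst (fun n => if n is m.+1 then Var m else t) p.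

(* inst p v: the variable i of p is replaced by the variable v i. *)
Definition inst p (v : nat -> nat) := subst (fun n => Var (v n)) p.

(* All free variables are below k. *)
Fixpoint bounded_term k t : bool :=
  match t with
  | Var n => n < k
  | App f ts => [forall i, bounded_term k (ts i)]
  end.

Fixpoint bounded k p : bool :=
  match p with
  | Bot => true
  | Eq t u => bounded_term k t && bounded_term k u
  | Rel r ts => [forall i, bounded_term k (ts i)]
  | Imp p q | And p q | Or p q => bounded k p && bounded k q
  | All p | Ex p => bounded k.+1 p
  end.

Definition sentence p := bounded 0 p.

End Syntax.

(* Classical natural deduction; contexts are arbitrary sets of formulas, of
   which a derivation, being a finite tree, uses only finitely many members.  *)

Section Deduction.
Variable L : signature.

Definition extend (T : form L -> Prop) (p : form L) : form L -> Prop :=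
  fun q => q = p \/ T q.

Definition shift_set (T : form L -> Prop) : form L -> Prop :=
  fun q => exists2 p, T p & q = shift p.

Inductive prv : (form L -> Prop) -> form L -> Prop :=
  | Hyp T p : T p -> prv T p
  | RAA T p : prv (extend T (Neg p)) Bot -> prv T p
  | ImpI T p q : prv (extend T p) q -> prv T (Imp p q)
  | ImpE T p q : prv T (Imp p q) -> prv T p -> prv T q
  | AndI T p q : prv T p -> prv T q -> prv T (And p q)
  | AndE1 T p q : prv T (And p q) -> prv T p
  | AndE2 T p q : prv T (And p q) -> prv T q
  | OrI1 T p q : prv T p -> prv T (Or p q)
  | OrI2 T p q : prv T q -> prv T (Or p q)
  | OrE T p q r :
      prv T (Or p q) -> prv (extend T p) r -> prv (extend T q) r -> prv T r
  | AllI T p : prv (shift_set T) p -> prv T (All p)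
  | AllE T p t : prv T (All p) -> prv T (subst1 p t)
  | ExI T p t : prv T (subst1 p t) -> prv T (Ex p)
  | ExE T p q :
      prv T (Ex p) -> prv (extend (shift_set T) p) (shift q) -> prv T q
  | EqI T t : prv T (Eq t t)
  | EqE T p t u : prv T (Eq t u) -> prv T (subst1 p t) -> prv T (subst1 p u).

End Deduction.

(* A theory is given by its set of axioms; it need not be deductively closed. *)
Record theory (L : signature) := Theory {
  axiom :> form L -> Prop;
  axiomP : forall p, axiom p -> sentence p }.

Definition deductively_equivalent (L : signature) (T W : theory L) :=
  forall p : form L, sentence p -> (prv T p <-> prv W p).

Lemma theory_union_subproof (L : signature) (T W : theory L) (p : form L) :
  T p \/ W p -> sentence p.
Proof. by case; apply: axiomP. Qed.

Definition theory_union (L : signature) (T W : theory L) : theory L :=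
  Theory (@theory_union_subproof L T W).

(* Partial recursive functions; in RPrec f g and RMu f the recursion (search)
   variable is the first argument.                                            *)
Inductive recfun :=
  | RZero
  | RSucc
  | RProj of nat
  | RComp of recfun & seq recfun
  | RPrec of recfun & recfun
  | RMu of recfun.

Inductive rec_eval : recfun -> seq nat -> nat -> Prop :=
  | EZero xs : rec_eval RZero xs 0
  | ESucc x xs : rec_eval RSucc (x :: xs) x.+1
  | EProj i xs : i < size xs -> rec_eval (RProj i) xs (nth 0 xs i)
  | EComp f gs xs ys y :
      rec_evals gs xs ys -> rec_eval f ys y -> rec_eval (RComp f gs) xs y
  | EPrec0 f g xs y : rec_eval f xs y -> rec_eval (RPrec f g) (0 :: xs) y
  | EPrecS f g n xs y z :
      rec_eval (RPrec f g) (n :: xs) y -> rec_eval g [:: n, y & xs] z ->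
      rec_eval (RPrec f g) (n.+1 :: xs) z
  | EMu f xs n :
      (forall m, m < n -> exists k, rec_eval f (m :: xs) k.+1) ->
      rec_eval f (n :: xs) 0 -> rec_eval (RMu f) xs n
with rec_evals : seq recfun -> seq nat -> seq nat -> Prop :=
  | ENil xs : rec_evals [::] xs [::]
  | ECons g gs xs y ys :
      rec_eval g xs y -> rec_evals gs xs ys ->
      rec_evals (g :: gs) xs (y :: ys).

Definition computable (h : nat -> nat) :=
  exists f, forall n, rec_eval f [:: n] (h n).

Definition ce_set (A : nat -> Prop) :=
  (forall n, ~ A n) \/
  (exists2 h, computable h & forall n, A n <-> exists k, h k = n).

Section Godel.
Variable L : signature.

Fixpoint godel_term (t : term L) : nat :=
  CodeSeq.code
    match t with
    | Var n => [:: 0; n]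
    | App f ts => [:: 1, pickle f & [seq godel_term (ts i) | i <- enum 'I_(far f)]]
    end.

Fixpoint godel (p : form L) : nat :=
  CodeSeq.code
    match p with
    | Bot => [:: 0]
    | Eq t u => [:: 1; godel_term t; godel_term u]
    | Rel r ts => [:: 2, pickle r & [seq godel_term (ts i) | i <- enum 'I_(rar r)]]
    | Imp p q => [:: 3; godel p; godel q]
    | And p q => [:: 4; godel p; godel q]
    | Or p q => [:: 5; godel p; godel q]
    | All p => [:: 6; godel p]
    | Ex p => [:: 7; godel p]
    end.

Local Arguments CodeSeq.code : simpl never.

Let code_inj : injective CodeSeq.code := can_inj CodeSeq.codeK.

Lemma godel_term_inj : injective godel_term.
Proof.
elim/term_ind_ffun=> [n|f ts IH] [m|g us] //= /code_inj //.
- by case=> ->.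
- case=> /(pcan_inj pickleK) efg; move: us; rewrite -efg => us e.
  congr App; apply/ffunP=> i; apply: IH.
  by move/eq_in_map: e => /(_ i); apply; rewrite mem_enum.
Qed.

Lemma godel_inj : injective godel.
Proof.
elim=> [|t u|r ts|p IHp q IHq|p IHp q IHq|p IHp q IHq|p IHp|p IHp]
  [|t' u'|r' ts'|p' q'|p' q'|p' q'|p'|p'] //= /code_inj //.
- by case=> /godel_term_inj -> /godel_term_inj ->.
- case=> /(pcan_inj pickleK) err; move: ts'; rewrite -err => ts' e.
  congr Rel; apply/ffunP=> i; apply: godel_term_inj.
  by move/eq_in_map: e => /(_ i); apply; rewrite mem_enum.
- by case=> /IHp -> /IHq ->.
- by case=> /IHp -> /IHq ->.
- by case=> /IHp -> /IHq ->.
- by case=> /IHp ->.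
- by case=> /IHp ->.
Qed.

Definition ce_theory (T : theory L) :=
  ce_set (fun n => exists2 p, T p & godel p = n).

End Godel.

(* One-dimensional and parameter-free.  The formula of a k-ary symbol has its
   arguments at the variables 0, ..., k - 1; the graph of a k-ary function has
   its value at the variable k.                                               *)
Record translation (Th Xi : signature) := Translation {
  tdom : form Xi;
  teq : form Xi;
  tfun : fsym Th -> form Xi;
  trel : rsym Th -> form Xi;
  tdomP : bounded 1 tdom;
  teqP : bounded 2 teq;
  tfunP : forall f, bounded (far f).+1 (tfun f);
  trelP : forall r, bounded (rar r) (trel r) }.

Definition coincide (Th Xi : signature) (t u : translation Th Xi) :=
  [/\ tdom t = tdom u, teq t = teq u,
      forall f, tfun t f = tfun u f & forall r, trel t r = trel u r].

Section Translate.
Variables (Th Xi : signature) (tau : translation Th Xi).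

(* unnest args rho vs body replaces the arguments of a symbol by variables of
   the target and passes these, appended to vs, to body.  An argument inl x is
   the source variable x, interpreted by rho x; inr D is a compound term, which
   receives a fresh variable, quantified over the domain and described by D.   *)
Fixpoint unnest (args : seq (nat + ((nat -> nat) -> nat -> form Xi)))
    (rho : nat -> nat) (vs : seq nat) (body : seq nat -> form Xi) : form Xi :=
  match args with
  | [::] => body vs
  | inl x :: args' => unnest args' rho (rcons vs (rho x)) body
  | inr D :: args' =>
      let rho' x := (rho x).+1 in
      Ex (And (tdom tau)
        (And (D rho' 0) (unnest args' rho' (rcons (map S vs) 0) body)))
  end.

(* denotes t rho v: the value of t is v.  The list handed to the body has v in
   front of the arguments; rot 1 moves it to the end.                         *)
Fixpoint denotes (t : term Th) (rho : nat -> nat) (v : nat) : form Xi :=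
  match t with
  | Var x => inst (teq tau) (nth 0 [:: rho x; v])
  | App f ts =>
      unnest [seq (if ts i is Var x then inl x else inr (denotes (ts i)))
               | i <- enum 'I_(far f)]
        rho [:: v] (fun vs => inst (tfun tau f) (nth 0 (rot 1 vs)))
  end.

Definition trans_eq (rho : nat -> nat) (t u : term Th) : form Xi :=
  match t, u with
  | _, Var y => denotes t rho (rho y)
  | Var x, _ => denotes u rho (rho x)
  | _, _ =>
      let rho' x := (rho x).+1 in
      Ex (And (tdom tau) (And (denotes t rho' 0) (denotes u rho' 0)))
  end.

Definition trans_rel (rho : nat -> nat) (r : rsym Th)
    (ts : {ffun 'I_(rar r) -> term Th}) : form Xi :=
  unnest [seq (if ts i is Var x then inl x else inr (denotes (ts i)))
           | i <- enum 'I_(rar r)]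
    rho [::] (fun vs => inst (trel tau r) (nth 0 vs)).

Definition up_ren (rho : nat -> nat) (n : nat) :=
  if n is m.+1 then (rho m).+1 else 0.

Fixpoint trans (rho : nat -> nat) (p : form Th) : form Xi :=
  match p with
  | Bot => Bot
  | Eq t u => trans_eq rho t u
  | Rel r ts => trans_rel rho ts
  | Imp p q => Imp (trans rho p) (trans rho q)
  | And p q => And (trans rho p) (trans rho q)
  | Or p q => Or (trans rho p) (trans rho q)
  | All p => All (Imp (tdom tau) (trans (up_ren rho) p))
  | Ex p => Ex (And (tdom tau) (trans (up_ren rho) p))
  end.

Definition translate (p : form Th) : form Xi := trans id p.

End Translate.

Section TranslateSentence.

Lemma bounded_term_subst (L : signature) k m (s : nat -> term L) t :
  (forall n, n < k -> bounded_term m (s n)) ->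
  bounded_term k t -> bounded_term m (subst_term s t).
Proof.
move=> Hs; elim/term_ind_ffun: t => [n|f ts IH] /=; first exact: Hs.
by move/forallP=> H; apply/forallP=> i; rewrite ffunE; apply: IH.
Qed.

Lemma bounded_subst (L : signature) (p : form L) k m (s : nat -> term L) :
  (forall n, n < k -> bounded_term m (s n)) ->
  bounded k p -> bounded m (subst s p).
Proof.
have Hup k' m' (s' : nat -> term L) :
    (forall n, n < k' -> bounded_term m' (s' n)) ->
    forall n, n < k'.+1 -> bounded_term m'.+1 (up s' n).
  move=> H [|n] //= /H; exact: bounded_term_subst.
elim: p k m s => [|t u|r ts|p IHp q IHq|p IHp q IHq|p IHp q IHq|p IHp|p IHp]
  k m s Hs //=.
- by case/andP=> *; rewrite !(bounded_term_subst Hs).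
- move/forallP=> H; apply/forallP=> i; rewrite ffunE.
  exact: bounded_term_subst Hs _.
- by case/andP=> /(IHp _ _ _ Hs)-> /(IHq _ _ _ Hs)->.
- by case/andP=> /(IHp _ _ _ Hs)-> /(IHq _ _ _ Hs)->.
- by case/andP=> /(IHp _ _ _ Hs)-> /(IHq _ _ _ Hs)->.
- exact/IHp/Hup.
- exact/IHp/Hup.
Qed.

Variables (Th Xi : signature) (tau : translation Th Xi).

Lemma bounded_dom m : bounded m.+1 (tdom tau).
Proof.
have weak_t (L : signature) k k' (t : term L) :
    k <= k' -> bounded_term k t -> bounded_term k' t.
  move=> lekk; elim/term_ind_ffun: t => [n|f ts IH] /=.
    by move/leq_trans; apply.
  by move/forallP=> H; apply/forallP=> i; apply: IH.
suff weak (p : form Xi) k k' : k <= k' -> bounded k p -> bounded k' p.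
  exact: weak (tdomP tau).
elim: p k k' => [|t u|r ts|p IHp q IHq|p IHp q IHq|p IHp q IHq|p IHp|p IHp]
  k k' le //=.
- by case/andP=> *; rewrite !(weak_t _ _ _ _ le).
- by move/forallP=> H; apply/forallP=> i; apply: weak_t le _.
- by case/andP=> /(IHp _ _ le)-> /(IHq _ _ le)->.
- by case/andP=> /(IHp _ _ le)-> /(IHq _ _ le)->.
- by case/andP=> /(IHp _ _ le)-> /(IHq _ _ le)->.
- exact: IHp.
- exact: IHp.
Qed.

Let maps k m (rho : nat -> nat) := forall n, n < k -> rho n < m.

Let argsP k (args : seq (nat + ((nat -> nat) -> nat -> form Xi))) :=
  forall i, i < size args -> match nth (inl 0) args i with
    | inl x => is_true (x < k)
    | inr D => forall m rho v, maps k m rho -> v < m -> bounded m (D rho v)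
    end.

Lemma bounded_unnest k args m rho vs body :
  argsP k args -> maps k m rho -> all (fun v => v < m) vs ->
  (forall m' vs', size vs' = size vs + size args ->
     all (fun v => v < m') vs' -> bounded m' (body vs')) ->
  bounded m (unnest tau args rho vs body).
Proof.
elim: args m rho vs => [|a args IH] m rho vs Ha Hr Hv Hb /=.
  by apply: Hb; rewrite ?addn0.
have Ha' : argsP k args by move=> i Hi; apply: (Ha i.+1).
case: a Ha Hb => [x|D] Ha Hb.
  apply: IH => //; first by rewrite all_rcons Hv andbT; apply: Hr (Ha 0 _).
  by move=> m' vs'; rewrite size_rcons addSnnS; apply: Hb.
have Hr' : maps k m.+1 (fun x => (rho x).+1) by move=> n /Hr.
rewrite /= bounded_dom /= (Ha 0 _ m.+1) //=; apply: IH => //.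
  by rewrite all_rcons /= all_map.
by move=> m' vs'; rewrite size_rcons size_map addSnnS; apply: Hb.
Qed.

Lemma bounded_inst (p : form Xi) k m vs :
  bounded k p -> size vs = k -> all (fun v => v < m) vs ->
  bounded m (inst p (nth 0 vs)).
Proof.
move=> Hp Hs /allP Hv; apply: bounded_subst Hp => n lt.
by apply: Hv; rewrite mem_nth // Hs.
Qed.

Lemma bounded_denotes t k m rho v :
  bounded_term k t -> maps k m rho -> v < m -> bounded m (denotes tau t rho v).
Proof.
elim/term_ind_ffun: t k m rho v => [n|f ts IH] k m rho v /=.
  move=> lt Hr Hv; apply: bounded_inst (teqP tau) _ _ => //=.
  by rewrite Hv Hr.
move=> /forallP Hts Hr Hv; apply: (bounded_unnest (k := k)) => //=.
- move=> i; rewrite size_map size_enum_ord => lt.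
  rewrite (nth_map (Ordinal lt)) ?size_enum_ord //.
  set j := nth _ _ _; case E: (ts j) (Hts j) => [x|g us] //= H m' rho' v'.
  by have := IH j k m' rho' v'; rewrite E; apply.
- by rewrite Hv.
- move=> m' vs'; rewrite size_map size_enum_ord => Hs Ha.
  apply: bounded_inst (tfunP tau f) _ _; first by rewrite size_rot Hs.
  by rewrite (eq_all_r (mem_rot 1 vs')).
Qed.

Lemma bounded_trans p k m rho :
  bounded k p -> maps k m rho -> bounded m (trans tau rho p).
Proof.
have Hup k' m' rho' : maps k' m' rho' -> maps k'.+1 m'.+1 (up_ren rho').
  by move=> H [|n] //= /H.
elim: p k m rho => [|t u|r ts|p IHp q IHq|p IHp q IHq|p IHp q IHq|p IHp|p IHp]
  k m rho //=.
- case/andP=> Ht Hu Hr.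
  have Hr' : maps k m.+1 (fun x => (rho x).+1) by move=> n /Hr.
  case: t u Ht Hu => [x|f ts] [y|g us] Ht Hu;
    rewrite /trans_eq; try by apply: (@bounded_denotes _ k) => //; apply: Hr.
  have H1 := @bounded_denotes _ k m.+1 (fun x => (rho x).+1) 0 Ht Hr' isT.
  have H2 := @bounded_denotes _ k m.+1 (fun x => (rho x).+1) 0 Hu Hr' isT.
  exact/and3P/(And3 (bounded_dom m) H1 H2).
- move=> /forallP Hts Hr; apply: (bounded_unnest (k := k)) => //=.
    move=> i; rewrite size_map size_enum_ord => lt.
    rewrite (nth_map (Ordinal lt)) ?size_enum_ord //.
    set j := nth _ _ _; case: (ts j) (Hts j) => [x|g us] H; first exact: H.
    by move=> m' rho' v'; apply: bounded_denotes H.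
  move=> m' vs'; rewrite size_map size_enum_ord => Hs Ha.
  exact: bounded_inst (trelP tau r) _ _.
- by case/andP=> /IHp H /IHq H' Hr; rewrite H ?H'.
- by case/andP=> /IHp H /IHq H' Hr; rewrite H ?H'.
- by case/andP=> /IHp H /IHq H' Hr; rewrite H ?H'.
- by move=> /IHp H /Hup Hr; rewrite bounded_dom H.
- by move=> /IHp H /Hup Hr; rewrite bounded_dom H.
Qed.

Lemma translate_theory_subproof (T : theory Th) (q : form Xi) :
  (exists2 p, T p & q = translate tau p) -> sentence q.
Proof. by case=> p /axiomP Tp ->; apply: bounded_trans Tp _. Qed.

Definition translate_theory (T : theory Th) : theory Xi :=
  Theory (@translate_theory_subproof T).

End TranslateSentence.

(* The function symbols enter through equations f(x) = y between variables,
   which translations send to the graph of f.  The axioms for f are valid here,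
   but their translations say that the graph is total and single-valued and
   respects identity.                                                         *)
Section Identity.
Variable L : signature.

Definition AppV (f : fsym L) (k : nat) : term L :=
  App [ffun i : 'I_(far f) => Var (k + i)].

Definition RelV (r : rsym L) (k : nat) : form L :=
  Rel [ffun i : 'I_(rar r) => Var (k + i)].

(* x_0 = y_0 -> ... -> x_{n-1} = y_{n-1} -> p, with x_i at i and y_i at n + i *)
Definition eqs_imp (n : nat) (p : form L) : form L :=
  foldr (fun i => Imp (Eq (Var i) (Var (n + i)))) p (iota 0 n).

Inductive id_axiom : form L -> Prop :=
  | id_refl : id_axiom (All (Eq (Var 0) (Var 0)))
  | id_sym : id_axiom (Alls 2 (Imp (Eq (Var 0) (Var 1)) (Eq (Var 1) (Var 0))))
  | id_trans : id_axiom (Alls 3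
      (Imp (Eq (Var 0) (Var 1)) (Imp (Eq (Var 1) (Var 2)) (Eq (Var 0) (Var 2)))))
  | id_rel r : id_axiom (Alls (rar r + rar r)
      (eqs_imp (rar r) (Imp (RelV r 0) (RelV r (rar r)))))
  | id_fun f : id_axiom (Alls ((far f).+1 + (far f).+1)
      (eqs_imp (far f).+1
        (Imp (Eq (AppV f 0) (Var (far f)))
             (Eq (AppV f (far f).+1) (Var ((far f).+1 + far f))))))
  | id_total f : id_axiom (Alls (far f) (Ex (Eq (AppV f 1) (Var 0))))
  | id_functional f : id_axiom (Alls (far f).+2
      (Imp (Eq (AppV f 2) (Var 0))
        (Imp (Eq (AppV f 2) (Var 1)) (Eq (Var 0) (Var 1))))).

Lemma bounded_Alls n k (p : form L) : bounded k (Alls n p) = bounded (n + k) p.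
Proof. by elim: n k => //= n IH k; rewrite IH addnS. Qed.

Lemma bounded_AppV f k m : k + far f <= m -> bounded_term m (AppV f k).
Proof.
move=> le; apply/forallP=> i; rewrite ffunE /=.
by apply: leq_trans le; rewrite ltn_add2l.
Qed.

Lemma bounded_RelV r k m : k + rar r <= m -> bounded m (RelV r k).
Proof.
move=> le; apply/forallP=> i; rewrite ffunE /=.
by apply: leq_trans le; rewrite ltn_add2l.
Qed.

Lemma bounded_eqs_imp n p : bounded (n + n) p -> bounded (n + n) (eqs_imp n p).
Proof.
move=> Hp; rewrite /eqs_imp.
have : all (fun i => i < n) (iota 0 n) by apply/allP=> i; rewrite mem_iota.
elim: (iota 0 n) => //= i s IH /andP[lt /IH ->].
by rewrite ltn_add2l lt andbT (leq_trans lt) ?leq_addr.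
Qed.

Lemma id_axiom_sentence p : id_axiom p -> sentence p.
Proof.
rewrite /sentence; case=> // [r|f|f|f]; rewrite bounded_Alls addn0.
- by apply/bounded_eqs_imp/andP; split; apply: bounded_RelV; rewrite ?leq_addr.
- apply/bounded_eqs_imp/andP; split; apply/andP; split.
  + by apply: bounded_AppV; rewrite add0n addSn leqW // addnS leqW // leq_addr.
  + by rewrite /= addSn ltnS leq_addr.
  + by apply: bounded_AppV; rewrite leq_add2l.
  + by rewrite /= ltn_add2l.
- by rewrite /= andbT; apply/forallP=> i; rewrite ffunE /= add1n ltnS.
- have H : bounded_term (far f).+2 (AppV f 2) by apply: bounded_AppV; rewrite add2n.
  by apply/and3P; split; apply/andP; split.
Qed.

Definition identity_theory : theory L := Theory id_axiom_sentence.

End Identity.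

Section Expansion.
Variables (L : signature) (k : nat).

(* None is the new predicate, of arity k. *)
Definition expand : signature :=
  @Signature (fsym L) (option (rsym L)) (@far L)
    (fun r : option (rsym L) => if r is Some s then rar s else k).

Fixpoint embed_term (t : term L) : term expand :=
  match t with
  | Var n => Var n
  | App f ts => @App expand f [ffun i => embed_term (ts i)]
  end.

Fixpoint embed (p : form L) : form expand :=
  match p with
  | Bot => Bot
  | Eq t u => Eq (embed_term t) (embed_term u)
  | Rel r ts => @Rel expand (Some r) [ffun i => embed_term (ts i)]
  | Imp p q => Imp (embed p) (embed q)
  | And p q => And (embed p) (embed q)
  | Or p q => Or (embed p) (embed q)
  | All p => All (embed p)
  | Ex p => Ex (embed p)
  end.

Lemma bounded_embed_term m t : bounded_term m t -> bounded_term m (embed_term t).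
Proof.
elim/term_ind_ffun: t => //= f ts IH /forallP H.
by apply/forallP=> i; rewrite ffunE IH.
Qed.

Lemma bounded_embed m p : bounded m p -> bounded m (embed p).
Proof.
elim: p m => //= [t u|r ts|p IHp q IHq|p IHp q IHq|p IHp q IHq|p IHp|p IHp] m.
- by case/andP=> *; rewrite !bounded_embed_term.
- by move/forallP=> H; apply/forallP=> i; rewrite ffunE bounded_embed_term.
- by case/andP=> /IHp-> /IHq->.
- by case/andP=> /IHp-> /IHq->.
- by case/andP=> /IHp-> /IHq->.
- exact: IHp.
- exact: IHp.
Qed.

Definition restrict (Xi : signature) (tau : translation expand Xi) :
    translation L Xi :=
  @Translation L Xi (tdom tau) (teq tau) (tfun tau)
    (fun r => trel tau (Some r : rsym expand))
    (tdomP tau) (teqP tau) (tfunP tau)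
    (fun r => trelP tau (Some r : rsym expand)).

End Expansion.

Variant arith_fun := AZero | ASucc | AAdd | AMul.

Definition arith_fun_code f :=
  match f with AZero => 0 | ASucc => 1 | AAdd => 2 | AMul => 3 end.
Definition arith_fun_decode n :=
  match n with 0 => AZero | 1 => ASucc | 2 => AAdd | _ => AMul end.
Lemma arith_fun_codeK : cancel arith_fun_code arith_fun_decode.
Proof. by case. Qed.
HB.instance Definition _ := Countable.copy arith_fun (can_type arith_fun_codeK).

Variant arith_rel := ALe.

Definition arith_rel_code (r : arith_rel) := tt.
Lemma arith_rel_codeK : cancel arith_rel_code (fun=> ALe).
Proof. by case. Qed.
HB.instance Definition _ := Countable.copy arith_rel (can_type arith_rel_codeK).

Definition La : signature :=
  @Signature arith_fun arith_rel
    (fun f => match f with AZero => 0 | ASucc => 1 | AAdd | AMul => 2 end)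
    (fun r => 2).

Definition Lap : signature := expand La 1.

Definition tZero : term La := @App La AZero [ffun i => Var 0].
Definition tSucc (t : term La) : term La := @App La ASucc [ffun i => t].
Definition tAdd (t u : term La) : term La :=
  @App La AAdd [ffun i => if val i == 0 then t else u].
Definition tMul (t u : term La) : term La :=
  @App La AMul [ffun i => if val i == 0 then t else u].
Definition fLe (t u : term La) : form La :=
  @Rel La ALe [ffun i => if val i == 0 then t else u].
Definition fP (t : term Lap) : form Lap := @Rel Lap None [ffun i => t].

Definition numeral (n : nat) : term La := iter n tSucc tZero.

Inductive R0_axiom : form La -> Prop :=
  | R0_add m n :
      R0_axiom (Eq (tAdd (numeral m) (numeral n)) (numeral (m + n)))
  | R0_mul m n :
      R0_axiom (Eq (tMul (numeral m) (numeral n)) (numeral (m * n)))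
  | R0_neq m n : m <> n -> R0_axiom (Neg (Eq (numeral m) (numeral n)))
  | R0_le_or n :
      R0_axiom (All (Imp (fLe (Var 0) (numeral n))
        (BigOr [seq Eq (Var 0) (numeral i) | i <- iota 0 n.+1])))
  | R0_le m n : m <= n -> R0_axiom (fLe (numeral m) (numeral n)).

Lemma bounded_numeral k n : bounded_term k (numeral n).
Proof.
elim: n => [|n IH] /=; first by apply/forallP=> -[].
by apply/forallP=> i; rewrite ffunE.
Qed.

Lemma R0_axiom_sentence p : R0_axiom p -> sentence p.
Proof.
have bn := bounded_numeral.
have two (k : nat) (t u : term La) :
    bounded_term k t -> bounded_term k u -> forall i : 'I_2,
    bounded_term k ([ffun i : 'I_2 => if val i == 0 then t else u] i).
  by move=> Ht Hu i; rewrite ffunE; case: ifP.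
rewrite /sentence; case=> [m n|m n|m n _|n|m n _].
- by apply/andP; split=> //; apply/forallP; apply: two.
- by apply/andP; split=> //; apply/forallP; apply: two.
- by apply/andP; split=> //; apply/andP; split.
- have H s : bounded 1 (BigOr [seq Eq (Var 0) (numeral i) | i <- s]).
    by elim: s => //= i s ->; rewrite bn.
  by apply/andP; split; [apply/forallP; apply: two | exact: (H (iota 0 n.+1))].
- by apply/forallP; apply: two.
Qed.

Definition R0 : theory La := Theory R0_axiom_sentence.

Inductive R0p_axiom : form Lap -> Prop :=
  | R0p_R0 p : R0 p -> R0p_axiom (embed 1 p)
  | R0p_P n : R0p_axiom (fP (embed_term 1 (numeral n))).

Lemma R0p_axiom_sentence p : R0p_axiom p -> sentence p.
Proof.
case=> [q /axiomP Hq|n]; first exact: bounded_embed.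
by apply/forallP=> i; rewrite ffunE bounded_embed_term ?bounded_numeral.
Qed.

Definition R0p : theory Lap := Theory R0p_axiom_sentence.

Definition id_ap : theory Lap := identity_theory Lap.

Definition R0p_sourced_by (L : signature) (tau : translation Lap L)
    (W : theory L) :=
  ce_theory W /\
  deductively_equivalent W (translate_theory tau (theory_union R0p id_ap)).

Definition R0p_sourced (L : signature) (W : theory L) :=
  exists tau : translation Lap L, R0p_sourced_by tau W.

(* Main.v *)
(** Keep the common arithmetical part of [tau] and [tau'] and translate [P] as
    the conjunction of the two translations of [P] together with the two
    sentences saying that these translations respect identity.  The conjunction
    of [P] and [P'] at a numeral follows in [U] and [V] together because
    "x is the n-th numeral" is provably single-valued up to translated identity;
    conversely the instance at the numeral 0 gives back the two congruence
    sentences, which the congruence of the conjunction alone would not. *)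

From Stdlib Require List.
From mathcomp Require Import all_boot.
Require Import Defs.

Set Implicit Arguments.
Unset Strict Implicit.
Unset Printing Implicit Defensive.

(** * Unions of computably enumerable sets *)

Lemma rec_eval_proj i xs y :
  i < size xs -> nth 0 xs i = y -> rec_eval (RProj i) xs y.
Proof. by move=> lt <-; apply: EProj. Qed.

(** A conditional by recursion on the test: the step receives the counter, the previous value, x and
    y, so position 3 is y. *)
Definition rec_if : recfun := RPrec (RProj 0) (RProj 3).

Lemma rec_ifP b x y :
  rec_eval rec_if [:: nat_of_bool b; x; y] (if b then y else x).
Proof.
have H0 : rec_eval rec_if [:: 0; x; y] x by apply/EPrec0/rec_eval_proj.
by case: b => //; apply: EPrecS H0 _; apply: rec_eval_proj.
Qed.

Definition rec_odd : recfun :=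
  RPrec RZero (RComp rec_if [:: RProj 1; RComp RSucc [:: RZero]; RZero]).

Lemma rec_oddP n : rec_eval rec_odd [:: n] (odd n).
Proof.
elim: n => [|n IH]; first exact/EPrec0/EZero.
apply: EPrecS IH _.
apply: (@EComp _ _ _ [:: nat_of_bool (odd n); 1; 0]); last first.
  by have := rec_ifP (odd n) 1 0; rewrite /=; case: (odd n).
apply: ECons; first exact: rec_eval_proj.
apply: ECons; last by apply: ECons; [apply: EZero | apply: ENil].
by apply: EComp (ESucc _ _); apply: ECons (EZero _) (ENil _).
Qed.

(** Half of n + 1 exceeds half of n exactly when n is odd. In the step, position 0 is the counter n
    and position 1 the previous value. *)
Definition rec_half : recfun :=
  RPrec RZero
    (RComp rec_if
       [:: RComp rec_odd [:: RProj 0]; RProj 1; RComp RSucc [:: RProj 1]]).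

Lemma rec_halfP n : rec_eval rec_half [:: n] n./2.
Proof.
elim: n => [|n IH]; first exact/EPrec0/EZero.
apply: EPrecS IH _.
apply: (@EComp _ _ _ [:: nat_of_bool (odd n); n./2; n./2.+1]); last first.
  rewrite [n.+1./2]/= uphalf_half.
  by have := rec_ifP (odd n) n./2 n./2.+1; case: (odd n).
apply: ECons.
  by apply: EComp (rec_oddP n); apply: ECons (ENil _); apply: rec_eval_proj.
apply: ECons; first exact: rec_eval_proj.
apply: ECons (ENil _); apply: EComp (ESucc _ [::]).
by apply: ECons (ENil _); apply: rec_eval_proj.
Qed.

Lemma ce_set_ext (A B : nat -> Prop) :
  (forall n, A n <-> B n) -> ce_set A -> ce_set B.
Proof.
move=> eAB [A0|[h hc hA]]; [left=> n /eAB; exact: A0 | right; exists h => //].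
by move=> n; apply: iff_trans (iff_sym (eAB n)) (hA n).
Qed.

(** Two enumerations are interleaved, one on even and one on odd arguments. The empty set is treated
    apart, since it is not the range of a total function. *)
Lemma ce_set_union (A B : nat -> Prop) :
  ce_set A -> ce_set B -> ce_set (fun n => A n \/ B n).
Proof.
case=> [A0|[g [cg Hcg] gA]] HB.
  by apply: ce_set_ext HB => n; split=> [|[/A0|]] //; right.
case: HB => [B0|[h [ch Hch] hB]].
  apply: (@ce_set_ext A); first by move=> n; split=> [|[|/B0]] //; left.
  by right; exists g => //; exists cg.
right; exists (fun n => if odd n then h n./2 else g n./2).
  exists (RComp rec_if
    [:: rec_odd; RComp cg [:: rec_half]; RComp ch [:: rec_half]]) => n.
  apply: EComp (rec_ifP _ _ _); have Hh := rec_halfP n.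
  apply: ECons; first exact: rec_oddP.
  apply: ECons.
    by apply: EComp (Hcg _); apply: ECons Hh (ENil _).
  apply: ECons (ENil _).
  by apply: EComp (Hch _); apply: ECons Hh (ENil _).
move=> n; split=> [[/gA[k <-]|/hB[k <-]]|[k]].
- by exists k.*2; rewrite odd_double doubleK.
- by exists k.*2.+1; rewrite /= odd_double uphalf_double.
- by case: (odd k) => <-; [right; apply/hB | left; apply/gA]; exists k./2.
Qed.

Lemma ce_theory_union (L : signature) (U V : theory L) :
  ce_theory U -> ce_theory V -> ce_theory (theory_union U V).
Proof.
move=> HU HV; apply: ce_set_ext (ce_set_union HU HV) => n; split.
  by case=> -[p Hp <-]; exists p => //; [left | right].
by case=> p [] Hp <-; [left | right]; exists p.
Qed.

(** * Substitutions and renamings of variables *)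

Section Substitution.
Variable L : signature.
Implicit Types (t : term L) (p : form L) (s : nat -> term L).

Lemma eq_subst_term s s' t : s =1 s' -> subst_term s t = subst_term s' t.
Proof.
move=> e; elim/term_ind_ffun: t => //= f ts IH.
by congr App; apply/ffunP=> i; rewrite !ffunE.
Qed.

Lemma eq_up s s' : s =1 s' -> up s =1 up s'.
Proof. by move=> e [|n] //=; rewrite e. Qed.

Lemma eq_subst s s' p : s =1 s' -> subst s p = subst s' p.
Proof.
elim: p s s' => //= [t u|r ts|p IHp q IHq|p IHp q IHq|p IHp q IHq|p IH|p IH]
  s s' e.
- by rewrite !(eq_subst_term _ e).
- by congr Rel; apply/ffunP=> i; rewrite !ffunE; apply: eq_subst_term.
- by rewrite (IHp _ _ e) (IHq _ _ e).
- by rewrite (IHp _ _ e) (IHq _ _ e).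
- by rewrite (IHp _ _ e) (IHq _ _ e).
- by rewrite (IH _ _ (eq_up e)).
- by rewrite (IH _ _ (eq_up e)).
Qed.

Lemma eq_in_subst_term k s s' t : (forall n, n < k -> s n = s' n) ->
  bounded_term k t -> subst_term s t = subst_term s' t.
Proof.
move=> e; elim/term_ind_ffun: t => [n|f ts IH] /=; first exact: e.
move/forallP=> Hb; congr App; apply/ffunP=> i; rewrite !ffunE.
exact: IH.
Qed.

Lemma eq_in_up k s s' : (forall n, n < k -> s n = s' n) ->
  forall n, n < k.+1 -> up s n = up s' n.
Proof. by move=> e [|n] //= lt; rewrite e. Qed.

Lemma eq_in_subst k s s' p : (forall n, n < k -> s n = s' n) ->
  bounded k p -> subst s p = subst s' p.
Proof.
elim: p k s s' => //= [t u|r ts|p IHp q IHq|p IHp q IHq|p IHp q IHq|p IH|p IH]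
  k s s' e.
- by case/andP=> Ht Hu; rewrite !(eq_in_subst_term e).
- move/forallP=> Hb; congr Rel; apply/ffunP=> i; rewrite !ffunE.
  exact: eq_in_subst_term e _.
- by case/andP=> Hp Hq; rewrite (IHp _ _ _ e Hp) (IHq _ _ _ e Hq).
- by case/andP=> Hp Hq; rewrite (IHp _ _ _ e Hp) (IHq _ _ _ e Hq).
- by case/andP=> Hp Hq; rewrite (IHp _ _ _ e Hp) (IHq _ _ _ e Hq).
- by move=> Hp; rewrite (IH _ _ _ (eq_in_up e) Hp).
- by move=> Hp; rewrite (IH _ _ _ (eq_in_up e) Hp).
Qed.

Lemma up_rename (r : nat -> nat) :
  up (fun n => Var (r n) : term L) =1 fun n => Var (up_ren r n).
Proof. by case. Qed.

Lemma subst_term_rename (r : nat -> nat) s t :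
  subst_term s (subst_term (fun n => Var (r n)) t)
  = subst_term (fun n => s (r n)) t.
Proof.
elim/term_ind_ffun: t => //= f ts IH.
by congr App; apply/ffunP=> i; rewrite !ffunE.
Qed.

(** The inner substitution is a renaming, which passes under a binder without composing two term
    substitutions. Renamings suffice because the witnesses and instances chosen below are always
    variables. *)
Lemma subst_inst (r : nat -> nat) s p :
  subst s (inst p r) = subst (fun n => s (r n)) p.
Proof.
rewrite /inst.
elim: p r s => //= [t u|f ts|p IHp q IHq|p IHp q IHq|p IHp q IHq|p IH|p IH] r s.
- by rewrite !subst_term_rename.
- by congr Rel; apply/ffunP=> i; rewrite !ffunE subst_term_rename.
- by rewrite IHp IHq.
- by rewrite IHp IHq.
- by rewrite IHp IHq.
- rewrite (eq_subst p (up_rename r)) IH.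
  by congr All; apply: eq_subst; case.
- rewrite (eq_subst p (up_rename r)) IH.
  by congr Ex; apply: eq_subst; case.
Qed.

Lemma inst_inst (r r' : nat -> nat) p :
  inst (inst p r) r' = inst p (fun n => r' (r n)).
Proof. exact: subst_inst. Qed.

Lemma eq_inst (r r' : nat -> nat) p : r =1 r' -> inst p r = inst p r'.
Proof. by move=> e; apply: eq_subst => n; rewrite e. Qed.

Lemma eq_in_inst k (r r' : nat -> nat) p : (forall n, n < k -> r n = r' n) ->
  bounded k p -> inst p r = inst p r'.
Proof. by move=> e; apply: eq_in_subst => n /e ->. Qed.

Lemma subst_term_id t : subst_term Var t = t.
Proof.
elim/term_ind_ffun: t => //= f ts IH.
by congr App; apply/ffunP=> i; rewrite !ffunE.
Qed.

Lemma inst_id p : inst p id = p.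
Proof.
have upV : up (@Var L) =1 Var by case.
rewrite /inst.
elim: p => //= [t u|r ts|p -> q ->|p -> q ->|p -> q ->|p IH|p IH] //.
- by rewrite !subst_term_id.
- by congr Rel; apply/ffunP=> i; rewrite !ffunE subst_term_id.
- by rewrite (eq_subst _ upV) IH.
- by rewrite (eq_subst _ upV) IH.
Qed.

Lemma inst_sentence (r : nat -> nat) p : sentence p -> inst p r = p.
Proof. by move=> Hp; rewrite -[RHS]inst_id; apply: eq_in_inst Hp. Qed.

Lemma shift_sentence p : sentence p -> shift p = p.
Proof. exact: (inst_sentence S). Qed.

Lemma inst_All p r : inst (All p) r = All (inst p (up_ren r)).
Proof. by congr All; apply/eq_subst/up_rename. Qed.

Lemma inst_Ex p r : inst (Ex p) r = Ex (inst p (up_ren r)).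
Proof. by congr Ex; apply/eq_subst/up_rename. Qed.

Lemma inst_And p q r : inst (And p q) r = And (inst p r) (inst q r).
Proof. by []. Qed.

Definition cons_ren (x : nat) (r : nat -> nat) (n : nat) : nat :=
  if n is m.+1 then r m else x.

Lemma subst1_var p x : subst1 p (Var x) = inst p (cons_ren x id).
Proof. by apply: eq_subst; case. Qed.

(** Indices beyond the list go to the default variable 0. This value never shows when the free
    variables of [p] are below the size of [vs]. *)
Definition at_vars p (vs : seq nat) : form L := inst p (nth 0 vs).

Lemma inst_at_vars p vs r :
  bounded (size vs) p -> inst (at_vars p vs) r = at_vars p (map r vs).
Proof.
move=> Hp; rewrite /at_vars inst_inst; apply: eq_in_inst Hp => n lt.
by rewrite (nth_map 0).
Qed.

Lemma at_vars_at_vars p us vs : bounded (size us) p ->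
  at_vars (at_vars p us) vs = at_vars p (map (nth 0 vs) us).
Proof. exact: inst_at_vars. Qed.

Lemma inst_unary p r x : bounded 1 p -> r 0 = x -> inst p r = at_vars p [:: x].
Proof. by move=> Hp <-; apply: eq_in_inst Hp => -[|]. Qed.

Lemma at_vars_sentence p vs : sentence p -> at_vars p vs = p.
Proof. exact: inst_sentence. Qed.

Lemma at_vars0 p : bounded 1 p -> at_vars p [:: 0] = p.
Proof.
by move=> Hp; rewrite -[RHS]inst_id; apply: eq_in_inst Hp => -[|].
Qed.

End Substitution.

(** * Derivations: weakening, cut, deductive equivalence and sequents *)

Section Derivations.
Variable L : signature.
Implicit Types (p q : form L) (T W : form L -> Prop) (G : seq (form L)).

Lemma prv_weaken T T' p : (forall q, T q -> T' q) -> prv T p -> prv T' p.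
Proof.
move=> sub Hp; elim: Hp T' sub => {T p}.
- by move=> T p Tp T' sub; apply/Hyp/sub.
- move=> T p _ IH T' sub; apply/RAA/IH => q [->|/sub]; first by left.
  by right.
- move=> T p q _ IH T' sub; apply/ImpI/IH => r [->|/sub]; first by left.
  by right.
- by move=> T p q _ IH1 _ IH2 T' sub; apply: ImpE (IH1 _ sub) (IH2 _ sub).
- by move=> T p q _ IH1 _ IH2 T' sub; apply: AndI (IH1 _ sub) (IH2 _ sub).
- by move=> T p q _ IH T' sub; apply: AndE1 (IH _ sub).
- by move=> T p q _ IH T' sub; apply: AndE2 (IH _ sub).
- by move=> T p q _ IH T' sub; apply: OrI1 (IH _ sub).
- by move=> T p q _ IH T' sub; apply: OrI2 (IH _ sub).
- move=> T p q r _ IH _ IH1 _ IH2 T' sub; apply: OrE (IH _ sub) _ _.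
    by apply: IH1 => s [->|/sub]; [left | right].
  by apply: IH2 => s [->|/sub]; [left | right].
- by move=> T p _ IH T' sub; apply/AllI/IH => _ [q /sub Tq ->]; exists q.
- by move=> T p t _ IH T' sub; apply/AllE/IH.
- by move=> T p t _ IH T' sub; apply: (@ExI _ _ _ t); apply: IH.
- move=> T p q _ IH1 _ IH2 T' sub; apply: ExE (IH1 _ sub) _.
  apply: IH2 => r [->|[s /sub Ts ->]]; first by left.
  by right; exists s.
- by move=> T t T' _; apply: EqI.
- by move=> T p t u _ IH1 _ IH2 T' sub; apply: EqE (IH1 _ sub) (IH2 _ sub).
Qed.

(* The side formulas [D] are carried along so that only the sentences [U] have
   to be replaced under a quantifier rule; sentences are fixed by [shift]. *)
Lemma prv_cut_side (U : theory L) (W : theory L) T D p :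
  (forall q, U q -> prv W q) -> prv T p -> (forall q, T q -> U q \/ D q) ->
  prv (fun q => W q \/ D q) p.
Proof.
move=> UW Hp; elim: Hp D => {T p}.
- move=> T p Tp D /(_ _ Tp) [/UW|Dp]; last by apply: Hyp; right.
  by apply: prv_weaken => q; left.
- move=> T p _ IH D sub; apply: RAA.
  apply: prv_weaken (IH (extend D (Neg p)) _) => q.
    by case=> [|[]]; rewrite /extend; auto.
  by case=> [->|/sub[]]; rewrite /extend; auto.
- move=> T p q _ IH D sub; apply: ImpI.
  apply: prv_weaken (IH (extend D p) _) => r.
    by case=> [|[]]; rewrite /extend; auto.
  by case=> [->|/sub[]]; rewrite /extend; auto.
- by move=> T p q _ IH1 _ IH2 D sub; apply: ImpE (IH1 _ sub) (IH2 _ sub).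
- by move=> T p q _ IH1 _ IH2 D sub; apply: AndI (IH1 _ sub) (IH2 _ sub).
- by move=> T p q _ IH D sub; apply: AndE1 (IH _ sub).
- by move=> T p q _ IH D sub; apply: AndE2 (IH _ sub).
- by move=> T p q _ IH D sub; apply: OrI1 (IH _ sub).
- by move=> T p q _ IH D sub; apply: OrI2 (IH _ sub).
- move=> T p q r _ IH _ IH1 _ IH2 D sub; apply: OrE (IH _ sub) _ _.
    apply: prv_weaken (IH1 (extend D p) _) => s.
      by case=> [|[]]; rewrite /extend; auto.
    by case=> [->|/sub[]]; rewrite /extend; auto.
  apply: prv_weaken (IH2 (extend D q) _) => s.
    by case=> [|[]]; rewrite /extend; auto.
  by case=> [->|/sub[]]; rewrite /extend; auto.
- move=> T p _ IH D sub; apply: AllI.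
  apply: prv_weaken (IH (shift_set D) _) => q.
    case=> [Wq|[r Dr ->]]; last by exists r => //; right.
    by exists q; [left | rewrite shift_sentence ?(axiomP Wq)].
  case=> r /sub [Ur|Dr] ->; last by right; exists r.
  by left; rewrite shift_sentence ?(axiomP Ur).
- by move=> T p t _ IH D sub; apply/AllE/IH.
- by move=> T p t _ IH D sub; apply: (@ExI _ _ _ t); apply: IH.
- move=> T p q _ IH1 _ IH2 D sub; apply: ExE (IH1 _ sub) _.
  apply: prv_weaken (IH2 (extend (shift_set D) p) _) => r.
    case=> [Wr|[->|[s Ds ->]]]; first right.
    + by exists r; [left | rewrite shift_sentence ?(axiomP Wr)].
    + by left.
    + by right; exists s => //; right.
  case=> [->|[s /sub [Us|Ds] ->]]; first by right; left.
    by left; rewrite shift_sentence ?(axiomP Us).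
  by right; right; exists s.
- by move=> T t D _; apply: EqI.
- by move=> T p t u _ IH1 _ IH2 D sub; apply: EqE (IH1 _ sub) (IH2 _ sub).
Qed.

Lemma prv_cut (U W : theory L) p :
  (forall q, U q -> prv W q) -> prv U p -> prv W p.
Proof.
move=> UW Up.
have := prv_cut_side (D := fun=> False) UW Up (fun q Uq => or_introl Uq).
by apply: prv_weaken => q [].
Qed.

Lemma deductively_equivalent_axioms (U W : theory L) :
  (forall q, U q -> prv W q) -> (forall q, W q -> prv U q) ->
  deductively_equivalent U W.
Proof. by move=> UW WU p _; split; apply: prv_cut. Qed.

Lemma deductively_equivalent_trans (U V W : theory L) :
  deductively_equivalent U V -> deductively_equivalent V W ->
  deductively_equivalent U W.
Proof. by move=> UV VW p Hp; apply: iff_trans (UV p Hp) (VW p Hp). Qed.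

Lemma deductively_equivalent_union (U U' V V' : theory L) :
  deductively_equivalent U U' -> deductively_equivalent V V' ->
  deductively_equivalent (theory_union U V) (theory_union U' V').
Proof.
move=> eU eV; apply: deductively_equivalent_axioms => q.
  case=> Hq; [have/eU[H _] := axiomP Hq | have/eV[H _] := axiomP Hq].
    by apply: prv_weaken (H (Hyp Hq)) => r; left.
  by apply: prv_weaken (H (Hyp Hq)) => r; right.
case=> Hq; [have/eU[_ H] := axiomP Hq | have/eV[_ H] := axiomP Hq].
  by apply: prv_weaken (H (Hyp Hq)) => r; left.
by apply: prv_weaken (H (Hyp Hq)) => r; right.
Qed.

(** The axioms are sentences and fixed by [shift]. Keeping them apart from the open assumptions [G]
    means that a quantifier rule only maps [shift] over a finite list. *)
Definition sequent (W : theory L) G : form L -> Prop :=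
  fun q => W q \/ List.In q G.

Lemma prv_assume (W : theory L) G p : List.In p G -> prv (sequent W G) p.
Proof. by move=> Gp; apply: Hyp; right. Qed.

Lemma prv_theory (W : theory L) G p : prv W p -> prv (sequent W G) p.
Proof. by apply: prv_weaken => q; left. Qed.

Lemma prv_sequent0 (W : theory L) p : prv (sequent W [::]) p -> prv W p.
Proof. by apply: prv_weaken => q [|[]]. Qed.

Lemma prv_Imp_intro (W : theory L) G p q :
  prv (sequent W (p :: G)) q -> prv (sequent W G) (Imp p q).
Proof.
move=> H; apply: ImpI; apply: prv_weaken H => r.
by case=> [|[->|]]; rewrite /extend /sequent; auto.
Qed.

Lemma sequent_shift (W : theory L) G q :
  sequent W (map (@shift L) G) q -> shift_set (sequent W G) q.
Proof.
case=> [Wq|]; first by exists q; [left | rewrite shift_sentence ?(axiomP Wq)].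
elim: G => //= p G IH [<-|/IH [r [Wr|Gr] ->]].
- by exists p => //; right; left.
- by exists r => //; left.
- by exists r => //; right; right.
Qed.

Lemma prv_All_intro (W : theory L) G p :
  prv (sequent W (map (@shift L) G)) p -> prv (sequent W G) (All p).
Proof. by move=> H; apply: AllI; apply: prv_weaken H => r /sequent_shift. Qed.

Lemma prv_Ex_elim (W : theory L) G p q :
  List.In (Ex p) G -> prv (sequent W (p :: map (@shift L) G)) (shift q) ->
  prv (sequent W G) q.
Proof.
move=> Gp H; apply: ExE (prv_assume W Gp) _; apply: prv_weaken H => r.
case=> [Wr|[<-|Gr]]; [right | by left | right]; apply: sequent_shift.
  by left.
by right.
Qed.

Lemma prv_have (W : theory L) G p q :
  prv (sequent W G) p -> prv (sequent W (p :: G)) q -> prv (sequent W G) q.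
Proof. by move=> Hp /prv_Imp_intro Hq; apply: ImpE Hq Hp. Qed.

(** Unpacks the body of the existential formulas that [unnest] produces for one compound argument:
    domain, description of the witness, rest. *)
Lemma prv_And3_elim (W : theory L) G p q r s :
  prv (sequent W [:: p, q, r & G]) s ->
  prv (sequent W (And p (And q r) :: G)) s.
Proof.
move=> /prv_Imp_intro/prv_Imp_intro/prv_Imp_intro H.
have A := prv_assume W (or_introl erefl : List.In _ (And p (And q r) :: G)).
have {}H : prv (sequent W (And p (And q r) :: G)) (Imp r (Imp q (Imp p s))).
  by apply: prv_weaken H => u [Wu|Gu]; [left | right; right].
apply: ImpE (ImpE (ImpE H _) _) (AndE1 A).
  exact: AndE2 (AndE2 A).
exact: AndE1 (AndE2 A).
Qed.

(** The induction strips the outermost quantifier. Under the n remaining ones its variable has index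
    n, so it is instantiated by [v n], which joins the renaming [r] of the variables outside the
    block. *)
Lemma prv_Alls_relative (d q : form L) n (v r : nat -> nat) T :
  bounded 1 d -> prv T (inst (iter n (fun p => All (Imp d p)) q) r) ->
  (forall i, i < n -> prv T (at_vars d [:: v i])) ->
  prv T (inst q (fun i => if i < n then v i else r (i - n))).
Proof.
move=> Hd; elim: n r => [|n IH] r Hq Hv.
  rewrite (_ : inst q _ = inst q r) //.
  by apply: eq_inst => i; rewrite subn0.
rewrite [inst _ _](_ : _ = inst q
  (fun i => if i < n then v i else cons_ren (v n) r (i - n))).
  apply: IH => [|i lt]; last by apply: Hv; rewrite ltnS ltnW.
  move: Hq; rewrite iterS inst_All => /(AllE (Var (v n))).
  rewrite subst1_var inst_inst => Hq.
  rewrite (_ : inst _ _ = inst (iter n (fun p => All (Imp d p)) q)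
    (fun k => cons_ren (v n) id (up_ren r k))); last by apply: eq_inst; case.
  have Ed : inst d (fun k => cons_ren (v n) id (up_ren r k)) =
      at_vars d [:: v n] by apply: eq_in_inst Hd => -[|].
  by apply: ImpE Hq _; have := Hv n (ltnSn n); rewrite -Ed.
apply: eq_inst => i; rewrite ltnS leq_eqVlt.
case: (ltngtP i n) => //= [lt|->]; last by rewrite subnn.
by rewrite subnS -subn_gt0 in lt *; case: (i - n) lt.
Qed.

End Derivations.

(** * Translations that agree on the old signature *)

Section TranslateAgree.
Variables (L Xi : signature) (k : nat).
Implicit Types (s : translation (expand L k) Xi).

(** A syntactic test instead of membership in the image of [embed]: the identity axioms of the
    expanded signature are built there directly and not as embedded formulas. *)
Fixpoint new_free (p : form (expand L k)) : bool :=
  match p with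
  | Bot | Eq _ _ => true
  | Rel r _ => isSome (r : option (rsym L))
  | Imp p q | And p q | Or p q => new_free p && new_free q
  | All p | Ex p => new_free p
  end.

Lemma new_free_embed (p : form L) : new_free (embed k p).
Proof. by elim: p => //= p -> q ->. Qed.

Lemma new_free_Alls n p : new_free (Alls n p) = new_free p.
Proof. by elim: n. Qed.

Lemma new_free_eqs_imp n p : new_free (eqs_imp n p) = new_free p.
Proof. by rewrite /eqs_imp; elim: (iota 0 n). Qed.

(** Compound arguments are functions of a renaming and a variable, so they are compared
    pointwise. *)
Let eq_arg (a b : nat + ((nat -> nat) -> nat -> form Xi)) : Prop :=
  match a, b with
  | inl x, inl y => x = y
  | inr D, inr E => forall rho v, D rho v = E rho v
  | _, _ => False
  end.

Lemma eq_unnest s s' (I : Type) (F F' : I -> _) (l : seq I) rho vs body body' :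
  tdom s = tdom s' -> (forall i, eq_arg (F i) (F' i)) -> body =1 body' ->
  unnest s (map F l) rho vs body = unnest s' (map F' l) rho vs body'.
Proof.
move=> ed eF eb; elim: l rho vs => //= i l IH rho vs.
case: (F i) (F' i) (eF i) => [x|D] [y|E] //= e; first by rewrite e.
by rewrite ed e IH.
Qed.

Lemma denotes_coincide s s' t rho v :
  coincide (restrict s) (restrict s') -> denotes s t rho v = denotes s' t rho v.
Proof.
case=> /= ed ee ef er; elim/term_ind_ffun: t rho v => [x|f ts IH] rho v /=.
  by rewrite ee.
apply: eq_unnest => // [i|vs]; last by rewrite ef.
by case: (ts i) (IH i) => [x|g us].
Qed.

(** Domain, identity and function graphs belong to the restriction, and [new_free] excludes the only
    atoms on which the two translations may differ. *)
Lemma trans_coincide s s' p rho :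
  coincide (restrict s) (restrict s') -> new_free p ->
  trans s rho p = trans s' rho p.
Proof.
move=> c; have cd := fun t rho v => denotes_coincide t rho v c.
case: (c) => /= ed ee ef er.
elim: p rho => //= [t u|r ts|p IHp q IHq|p IHp q IHq|p IHp q IHq|p IH|p IH] rho.
- by case: t u => [x|f ts] [y|g us]; rewrite /trans_eq ?cd ?ed.
- case: r ts => [r|] //= ts _; apply: eq_unnest => // [i|vs].
    by case: (ts i) => [x|g us] // rho' v; apply: cd.
  by rewrite er.
- by case/andP=> /IHp -> /IHq ->.
- by case/andP=> /IHp -> /IHq ->.
- by case/andP=> /IHp -> /IHq ->.
- by move=> /IH ->; rewrite ed.
- by move=> /IH ->; rewrite ed.
Qed.

End TranslateAgree.

(** * Translated numerals and the translated predicate *)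

Section Numerals.
Variables (L : signature) (s : translation Lap L).

(* The translation of "the variable x equals the n-th numeral"; the assignment
   of the source variables plays no role as numerals are closed. *)
Fixpoint is_num (n x : nat) : form L :=
  if n is m.+1 then
    Ex (And (tdom s) (And (is_num m 0) (at_vars (tfun s ASucc) [:: 0; x.+1])))
  else at_vars (tfun s AZero) [:: x].

Lemma denotes_numeral n rho x :
  denotes s (embed_term 1 (numeral n)) rho x = is_num n x.
Proof.
elim: n rho x => [|n IH] rho x /=; first by rewrite enum_ord0.
rewrite enum_ordSl enum_ord0 /= !ffunE.
have := IH (fun y => (rho y).+1) 0.
(* [denotes] tests whether an argument is a variable; the case distinction exposes the function
   symbol at the head of the numeral. *)
by case: n {IH} => [|n] /= ->.
Qed.

Lemma inst_is_num n x r : inst (is_num n x) r = is_num n (r x).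
Proof.
elim: n x r => [|n IH] x r.
  by rewrite /= inst_at_vars //; apply: (tfunP s).
rewrite /= inst_Ex; congr Ex; congr And.
  by rewrite -[RHS]inst_id; apply: eq_in_inst (tdomP s) => -[|].
congr And; first exact: IH.
exact: (@inst_at_vars _ _ [:: 0; x.+1] (up_ren r) (tfunP s ASucc)).
Qed.

Lemma translate_fP_numeral n :
  translate s (fP (embed_term 1 (numeral n))) =
  Ex (And (tdom s) (And (is_num n 0) (at_vars (trel s None) [:: 0]))).
Proof.
rewrite /translate /= /trans_rel enum_ordSl enum_ord0 /= !ffunE.
have := denotes_numeral n (fun y => y.+1) 0.
by case: n => [|n] /= ->.
Qed.

Lemma translate_Alls_elim n p vs T :
  sentence (Alls n p) -> prv T (translate s (Alls n p)) -> size vs = n ->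
  (forall x, x \in vs -> prv T (at_vars (tdom s) [:: x])) ->
  prv T (at_vars (trans s (iter n up_ren id) p) vs).
Proof.
move=> Hs Hp sz Hv.
have Hb : sentence (translate s (Alls n p)) by apply: bounded_trans Hs _.
have E rho : trans s rho (Alls n p) =
    iter n (fun p => All (Imp (tdom s) p)) (trans s (iter n up_ren rho) p).
  by elim: n rho {Hs Hp sz Hb} => //= n IH rho; rewrite IH -iterSr.
(* A sentence may be renamed freely. The constant renaming 0 is chosen to match the default value of
   [nth 0 vs] outside the list. *)
move: Hp; rewrite -(inst_sentence (fun=> 0) Hb) /translate E => Hp.
have Hd i : i < n -> prv T (at_vars (tdom s) [:: nth 0 vs i]).
  by move=> lt; apply: Hv; rewrite mem_nth ?sz.
have Ev : (fun i => if i < n then nth 0 vs i else 0) =1 nth 0 vs.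
  by move=> i; case: ltnP => // le; rewrite nth_default ?sz.
by have := prv_Alls_relative (tdomP s) Hp Hd; rewrite (eq_inst _ Ev).
Qed.

(** This is [id_rel] for the predicate [None], the only identity axiom of [Lap] in which the new
    predicate occurs. *)
Definition cong_axiom : form Lap :=
  Alls 2 (eqs_imp 1 (Imp (RelV (None : rsym Lap) 0) (RelV (None : rsym Lap) 1))).

Definition cong_P : form L := translate s cong_axiom.

Lemma sentence_cong_P : sentence cong_P.
Proof.
apply: bounded_trans (id_axiom_sentence (id_rel (None : rsym Lap))) _.
by move=> n.
Qed.

Lemma cong_PE : cong_P = All (Imp (tdom s) (All (Imp (tdom s)
  (Imp (at_vars (teq s) [:: 0; 1])
    (Imp (at_vars (trel s None) [:: 0]) (at_vars (trel s None) [:: 1])))))).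
Proof.
by rewrite /cong_P /translate /= /trans_rel !enum_ordSl !enum_ord0 /= !ffunE.
Qed.

(** * Derived rules from the translated identity axioms *)

Section Rules.
Variable T : form L -> Prop.
Hypothesis Tid : forall p, id_ap p -> prv T (translate s p).

Let dom x : Prop := prv T (at_vars (tdom s) [:: x]).

Let at_eq x y vs : at_vars (at_vars (teq s) [:: x; y]) vs =
  at_vars (teq s) [:: nth 0 vs x; nth 0 vs y].
Proof. exact: (@at_vars_at_vars _ _ [:: x; y] vs (teqP s)). Qed.

Let at_P x vs : at_vars (at_vars (trel s None) [:: x]) vs =
  at_vars (trel s None) [:: nth 0 vs x].
Proof. exact: (@at_vars_at_vars _ _ [:: x] vs (trelP s None)). Qed.

Let at_zero x vs : at_vars (at_vars (tfun s AZero) [:: x]) vs =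
  at_vars (tfun s AZero) [:: nth 0 vs x].
Proof. exact: (@at_vars_at_vars _ _ [:: x] vs (tfunP s AZero)). Qed.

Let at_succ x y vs : at_vars (at_vars (tfun s ASucc) [:: x; y]) vs =
  at_vars (tfun s ASucc) [:: nth 0 vs x; nth 0 vs y].
Proof. exact: (@at_vars_at_vars _ _ [:: x; y] vs (tfunP s ASucc)). Qed.

Let at_Imp p q vs :
  @at_vars L (Imp p q) vs = Imp (at_vars p vs) (at_vars q vs).
Proof. by []. Qed.

Let axiom_at n p vs (q := trans s (iter n up_ren id) p) :
  sentence (Alls n p) -> prv T (translate s (Alls n p)) -> size vs = n ->
  foldr (fun x => and (dom x)) True vs -> prv T (at_vars q vs).
Proof.
move=> Hs Hp sz Hd; apply: translate_Alls_elim => // x.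
elim: (vs) Hd => //= y l IH [Hy /IH {}IH].
by rewrite inE => /orP[/eqP -> | /IH].
Qed.

(** The congruence sentence is a premise of its own, so that the rule can be applied to each of the
    two translated predicates. *)
Lemma prv_cong_P x y :
  prv T cong_P -> dom x -> dom y -> prv T (at_vars (teq s) [:: x; y]) ->
  prv T (at_vars (trel s None) [:: x]) -> prv T (at_vars (trel s None) [:: y]).
Proof.
move=> HC Hx Hy He Hp.
have := @axiom_at 2 _ [:: x; y]
  (id_axiom_sentence (id_rel (None : rsym Lap))) HC erefl.
rewrite /= /trans_rel !enum_ordSl !enum_ord0 /= !ffunE /= -!/(at_vars _ _).
rewrite !at_Imp at_eq !at_P /= => H; apply: ImpE (ImpE (H _) He) Hp.
by do !split.
Qed.

Lemma prv_teq_refl x : dom x -> prv T (at_vars (teq s) [:: x; x]).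
Proof.
move=> Hx; have := @axiom_at 1 _ [:: x]
  (id_axiom_sentence (@id_refl Lap)) (Tid (@id_refl Lap)) erefl.
rewrite /= -!/(at_vars _ _) at_eq /=; apply.
by do !split.
Qed.

Lemma prv_zero_functional x y : dom x -> dom y ->
  prv T (at_vars (tfun s AZero) [:: x]) ->
  prv T (at_vars (tfun s AZero) [:: y]) -> prv T (at_vars (teq s) [:: x; y]).
Proof.
move=> Hx Hy Zx Zy; have := @axiom_at 2 _ [:: x; y]
  (id_axiom_sentence (@id_functional Lap AZero))
  (Tid (@id_functional Lap AZero)) erefl.
rewrite /= !enum_ord0 /= -!/(at_vars _ _) !at_Imp !at_zero at_eq /= => H.
by apply: ImpE (ImpE (H _) Zx) Zy; do !split.
Qed.

Lemma prv_succ_functional x y z w : dom x -> dom y -> dom z -> dom w ->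
  prv T (at_vars (teq s) [:: z; w]) ->
  prv T (at_vars (tfun s ASucc) [:: z; x]) ->
  prv T (at_vars (tfun s ASucc) [:: w; y]) -> prv T (at_vars (teq s) [:: x; y]).
Proof.
move=> Hx Hy Hz Hw ezw Szx Swy.
(* Congruence of the successor graph, with [z] and [w] identified in the argument place and
   reflexivity in the value place, makes x a value at w. Functionality at w then identifies it with
   y. *)
have Swx : prv T (at_vars (tfun s ASucc) [:: w; x]).
  have := @axiom_at 4 _ [:: z; x; w; x]
    (id_axiom_sentence (@id_fun Lap ASucc)) (Tid (@id_fun Lap ASucc)) erefl.
  rewrite /= !enum_ordSl !enum_ord0 /= !ffunE /= -!/(at_vars _ _).
  rewrite !at_Imp !at_eq !at_succ /= => H.
  apply: ImpE (ImpE (ImpE (H _) ezw) (prv_teq_refl Hx)) Szx.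
  by do !split.
have := @axiom_at 3 _ [:: x; y; w]
  (id_axiom_sentence (@id_functional Lap ASucc))
  (Tid (@id_functional Lap ASucc)) erefl.
rewrite /= !enum_ordSl !enum_ord0 /= !ffunE /= -!/(at_vars _ _).
rewrite !at_Imp !at_succ at_eq /= => H.
by apply: ImpE (ImpE (H _) Swx) Swy; do !split.
Qed.

End Rules.

(** * Uniqueness of the n-th numeral up to translated identity *)

Lemma In_shift_at_vars p vs G : bounded (size vs) p ->
  List.In (at_vars p vs) G ->
  List.In (at_vars p (map S vs)) (map (@shift L) G).
Proof.
by move=> Hp; rewrite -(inst_at_vars S Hp); apply: List.in_map.
Qed.

Lemma In_shift_is_num n x G : List.In (is_num n x) G ->
  List.In (is_num n x.+1) (map (@shift L) G).
Proof. by rewrite -(inst_is_num n x S); apply: List.in_map. Qed.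

(** By induction on n, the two predecessors are identified, and the successor graph respects
    identity and is functional. The premises are memberships in [G], so the induction hypothesis
    applies in the context enlarged by the two predecessors. *)
Lemma prv_is_num_unique (W : theory L) n x y G :
  (forall p, id_ap p -> prv W (translate s p)) ->
  List.In (at_vars (tdom s) [:: x]) G -> List.In (at_vars (tdom s) [:: y]) G ->
  List.In (is_num n x) G -> List.In (is_num n y) G ->
  prv (sequent W G) (at_vars (teq s) [:: x; y]).
Proof.
move=> Wid.
have Tid G' p : id_ap p -> prv (sequent W G') (translate s p).
  by move=> Hp; apply/prv_theory/Wid.
elim: n x y G => [|n IH] x y G dx dy nx ny.
  by apply: (prv_zero_functional (Tid G)); apply: prv_assume.
have Dom := tdomP s; have Suc := tfunP s ASucc.
apply: (prv_Ex_elim nx); apply: prv_And3_elim.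
rewrite [shift _](@inst_at_vars _ _ [:: x; y] S) ?(teqP s) //.
have {}dx := @In_shift_at_vars _ [:: x] _ Dom dx.
have {}dy := @In_shift_at_vars _ [:: y] _ Dom dy.
have {}ny := In_shift_is_num ny.
apply: prv_Ex_elim; first by do 3 right; exact: ny.
apply: prv_And3_elim.
rewrite [shift _](@inst_at_vars _ _ [:: x.+1; y.+1] S) ?(teqP s) //.
have {}dx := @In_shift_at_vars _ [:: x.+1] _ Dom dx.
have {}dy := @In_shift_at_vars _ [:: y.+1] _ Dom dy.
rewrite /= [shift (at_vars _ _)](@inst_at_vars _ _ [:: 0; x.+1] S) //.
rewrite [shift (is_num _ _)]inst_is_num.
(* For the newest variable the domain assumption is the bare formula [tdom s]; it is brought into
   the form [at_vars] as well. *)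
rewrite [shift (tdom s)](inst_unary Dom erefl) -{1}(at_vars0 Dom).
(* The predecessor of x was introduced first and has been shifted to 1; that of y is 0. *)
apply: (prv_succ_functional (Tid _) (z := 1) (w := 0)).
- by apply: prv_assume; do 6 right.
- by apply: prv_assume; do 6 right.
- by apply: prv_assume; do 3 right; left.
- by apply: prv_assume; left.
- apply: IH; [by do 3 right; left | by left | by do 4 right; left |].
  by right; left.
- by apply: prv_assume; do 5 right; left.
- by apply: prv_assume; do 2 right; left.
Qed.

End Numerals.

Lemma is_num_coincide (L : signature) (s s' : translation Lap L) n x :
  coincide (restrict s) (restrict s') -> is_num s n x = is_num s' n x.
Proof.
by move=> c; rewrite -!(denotes_numeral _ n id) (denotes_coincide _ _ _ c).
Qed.

(** Isolates the two kinds of axioms that mention the new predicate; by [trans_coincide] all others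
    have the same translation under translations with coinciding restrictions. *)
Lemma R0p_id_cases p : theory_union R0p id_ap p ->
  [\/ new_free p, p = cong_axiom
    | exists n, p = fP (embed_term 1 (numeral n))].
Proof.
case=> [[q _|n]|].
- by constructor 1; apply: new_free_embed.
- by constructor 3; exists n.
case=> [||| [r|] |f|f|f]; try by constructor 1.
- by constructor 2.
- by constructor 1; rewrite new_free_Alls new_free_eqs_imp.
- by constructor 1; rewrite new_free_Alls.
- by constructor 1; rewrite new_free_Alls.
Qed.

(** * The joined translation and its equivalence with the union *)

Section Join.
Variables (L : signature) (s s' : translation Lap L).
Hypothesis agree : coincide (restrict s) (restrict s').

Let P := trel s None.
Let P' := trel s' None.

Definition join_P : form L := And (And P P') (And (cong_P s) (cong_P s')).

Definition join_trel (r : rsym Lap) : form L :=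
  if r is Some a then trel s (Some a) else join_P.

Lemma join_trelP r : bounded (rar r) (join_trel r).
Proof.
case: r => [a|]; first exact: (trelP s (Some a)).
have C t : bounded 1 (cong_P t : form L).
  by apply: bounded_trans (id_axiom_sentence (id_rel (None : rsym Lap))) _.
by apply/andP; split; apply/andP; split;
  [exact: (trelP s None) | exact: (trelP s' None) | exact: C | exact: C].
Qed.

Definition join : translation Lap L :=
  @Translation Lap L (tdom s) (teq s) (tfun s) join_trel
    (tdomP s) (teqP s) (tfunP s) join_trelP.

Let T := theory_union R0p id_ap.
Let W := theory_union (translate_theory s T) (translate_theory s' T).

Let Dom := tdomP s.

Lemma at_join_P x : at_vars join_P [:: x] =
  And (And (at_vars P [:: x]) (at_vars P' [:: x])) (And (cong_P s) (cong_P s')).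
Proof.
(* The closed conjuncts are written as instances of themselves, after which both sides agree by
   computation. *)
rewrite -[in RHS](at_vars_sentence [:: x] (sentence_cong_P s)).
by rewrite -[in RHS](at_vars_sentence [:: x] (sentence_cong_P s')).
Qed.

Lemma join_coincide : coincide (restrict join) (restrict s).
Proof. by []. Qed.

Lemma join_coincide' : coincide (restrict join) (restrict s').
Proof. exact: agree. Qed.

Let W_id p : id_ap p -> prv W (translate s p).
Proof. by move=> Hp; apply: Hyp; left; exists p => //; right. Qed.

Let W_cong : prv W (cong_P s).
Proof. exact/W_id/(id_rel (None : rsym Lap)). Qed.

Let W_cong' : prv W (cong_P s').
Proof.
apply: Hyp; right; exists cong_axiom => //; right.
exact: (id_rel (None : rsym Lap)).
Qed.

(** Domain and identity are taken from [s] and the congruence sentence from [s']; the agreement of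
    the restrictions makes them fit. *)
Let cong' G x y :
  prv (sequent W G) (at_vars (tdom s) [:: x]) ->
  prv (sequent W G) (at_vars (tdom s) [:: y]) ->
  prv (sequent W G) (at_vars (teq s) [:: x; y]) ->
  prv (sequent W G) (at_vars P' [:: x]) -> prv (sequent W G) (at_vars P' [:: y]).
Proof.
case: agree => /= ed ee _ _; rewrite ed ee => dx dy e.
exact: prv_cong_P (prv_theory _ W_cong') dx dy e.
Qed.

(** Each translated predicate is carried over by its own congruence sentence, and the two closed
    conjuncts are theorems of [W]. *)
Lemma prv_cong_join : prv W (cong_P join).
Proof.
rewrite cong_PE [tdom join]/= [teq join]/= [trel join None]/= !at_join_P.
apply: prv_sequent0.
apply: prv_All_intro; apply: prv_Imp_intro; apply: prv_All_intro.
do 3 apply: prv_Imp_intro.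
rewrite /= [shift _](inst_unary Dom erefl) -{1}(at_vars0 Dom).
set G := [:: _; _; _; _].
have PP0 : prv (sequent W G) (And (at_vars P [:: 0]) (at_vars P' [:: 0])).
  by apply: (AndE1 (q := And (cong_P s) (cong_P s'))); apply: prv_assume; left.
have e : prv (sequent W G) (at_vars (teq s) [:: 0; 1]).
  by apply: prv_assume; right; left.
have d0 : prv (sequent W G) (at_vars (tdom s) [:: 0]).
  by apply: prv_assume; do 2 right; left.
have d1 : prv (sequent W G) (at_vars (tdom s) [:: 1]).
  by apply: prv_assume; do 3 right; left.
apply: AndI; apply: AndI; try exact: prv_theory.
  exact: prv_cong_P (prv_theory _ W_cong) d0 d1 e (AndE1 PP0).
exact: cong' d0 d1 e (AndE2 PP0).
Qed.

Let sentence_P_numeral n (t : translation Lap L) :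
  sentence (translate t (fP (embed_term 1 (numeral n)))).
Proof. exact: bounded_trans (R0p_axiom_sentence (R0p_P n)) _. Qed.

Lemma prv_join_numeral n :
  prv W (translate join (fP (embed_term 1 (numeral n)))).
Proof.
have ed : tdom s = tdom s' by case: agree.
have T_P : T (fP (embed_term 1 (numeral n))) by left; constructor.
have A : prv W (translate s (fP (embed_term 1 (numeral n)))).
  by apply: Hyp; left; eexists; first exact: T_P.
have B : prv W (translate s' (fP (embed_term 1 (numeral n)))).
  by apply: Hyp; right; eexists; first exact: T_P.
have SB := sentence_P_numeral n s'.
have SJ := sentence_P_numeral n join.
rewrite translate_fP_numeral in A.
(* Both existential statements now use the domain and the numeral formula of [s], so their witnesses
   can be compared. *)
rewrite translate_fP_numeral -ed -(is_num_coincide n 0 agree) in B SB.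
apply: prv_sequent0.
apply: prv_have (prv_theory _ A) _; apply: prv_have (prv_theory _ B) _.
(* The witness from [A], satisfying [P], is opened first and ends up at 1; the witness from [B],
   satisfying [P'], is 0. *)
apply: prv_Ex_elim; first by right; left.
rewrite (shift_sentence SJ) [map _ _]/= (shift_sentence SB).
apply: prv_And3_elim; apply: prv_Ex_elim; first by do 3 right; left.
rewrite (shift_sentence SJ); apply: prv_And3_elim.
rewrite [map _ _]/= [shift (tdom s)](inst_unary Dom erefl).
rewrite [shift (is_num _ _ _)]inst_is_num.
rewrite [shift (at_vars (trel s _) _)]
  (@inst_at_vars _ _ [:: 0] _ (trelP s None)).
rewrite -{1}(at_vars0 Dom).
set G := [:: _, _, _, _, _, _ & _].
(* The witness for [P] is kept; [P'] is moved to it from 0 along the uniqueness of the n-th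
   numeral. *)
rewrite translate_fP_numeral; apply: (@ExI _ _ _ (Var 1)).
rewrite subst1_var 2!inst_And (inst_unary (tdomP join) erefl) inst_is_num.
rewrite (@inst_at_vars _ _ [:: 0] _ (trelP join None)).
have d0 : List.In (at_vars (tdom s) [:: 0]) G by left.
have d1 : List.In (at_vars (tdom s) [:: 1]) G by do 3 right; left.
have n0 : List.In (is_num s n 0) G by right; left.
have n1 : List.In (is_num s n 1) G by do 4 right; left.
have P1 : prv (sequent W G) (at_vars P [:: 1]).
  by apply: prv_assume; do 5 right; left.
have P1' : prv (sequent W G) (at_vars P' [:: 1]).
  apply: (cong' (x := 0)); try exact: prv_assume.
    exact: prv_is_num_unique d0 d1 n0 n1.
  by apply: prv_assume; do 2 right; left.
apply: AndI; [|apply: AndI].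
- exact: prv_assume.
- exact: prv_assume.
rewrite [trel _ _]/= at_join_P.
by apply: AndI; apply: AndI => //; apply: prv_theory.
Qed.

Let J := translate_theory join T.

Let prv_J_numeral n : prv J (Ex (And (tdom s) (And (is_num s n 0)
  (And (And (at_vars P [:: 0]) (at_vars P' [:: 0]))
    (And (cong_P s) (cong_P s')))))).
Proof.
rewrite -at_join_P -[And _ _]/(And (tdom join) (And (is_num join n 0)
  (at_vars (trel join None) [:: 0]))) -translate_fP_numeral.
by apply: Hyp; exists (fP (embed_term 1 (numeral n))) => //; left; constructor.
Qed.

Lemma prv_join_cong : prv J (And (cong_P s) (cong_P s')).
Proof.
(* Any numeral would do: the wanted conjunct is closed, so it survives the elimination of the
   witness. *)
apply: prv_sequent0; apply: prv_have (prv_theory _ (prv_J_numeral 0)) _.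
apply: prv_Ex_elim; first by left.
have SC : sentence (And (cong_P s) (cong_P s')).
  by apply/andP; split; apply: sentence_cong_P.
rewrite (shift_sentence SC); apply: prv_And3_elim.
apply: (AndE2 (p := And (at_vars P [:: 0]) (at_vars P' [:: 0]))).
by apply: prv_assume; do 2 right; left.
Qed.

(** Serves for both [s] and [s']: the witness of the joined statement is reused, and the first
    premise projects the joined predicate to that of [t]. *)
Lemma prv_join_P n (t : translation Lap L) :
  (forall G, prv (sequent J (And (And (at_vars P [:: 0]) (at_vars P' [:: 0]))
     (And (cong_P s) (cong_P s')) :: G)) (at_vars (trel t None) [:: 0])) ->
  coincide (restrict s) (restrict t) ->
  prv J (translate t (fP (embed_term 1 (numeral n)))).
Proof.
move=> Ht c; have St := sentence_P_numeral n t.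
have ed : tdom s = tdom t by case: c.
apply: prv_sequent0; apply: prv_have (prv_theory _ (prv_J_numeral n)) _.
apply: prv_Ex_elim; first by left.
rewrite (shift_sentence St); apply: prv_And3_elim.
rewrite translate_fP_numeral -ed -(is_num_coincide n 0 c).
apply: (@ExI _ _ _ (Var 0)).
rewrite subst1_var 2!inst_And (inst_unary Dom erefl) inst_is_num (at_vars0 Dom).
rewrite (@inst_at_vars _ _ [:: 0] _ (trelP t None)).
apply: AndI; [|apply: AndI].
- by apply: prv_assume; left.
- by apply: prv_assume; right; left.
by apply: prv_weaken (Ht _) => r [Jr|Gr]; [left | do 3 right; exact: Gr].
Qed.

(** Axioms are compared one by one. Those without the new predicate have literally the same
    translation, which leaves its congruence axiom and its instances at numerals. *)
Lemma join_equivalent : deductively_equivalent W J.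
Proof.
apply: deductively_equivalent_axioms => q.
  case=> -[p Tp ->].
    case: (R0p_id_cases Tp) => [np|->|[n ->]].
    + apply: Hyp; exists p => //.
      exact: (esym (trans_coincide id join_coincide np)).
    + exact: AndE1 prv_join_cong.
    apply: prv_join_P => // G.
    by apply: AndE1; apply: AndE1; apply: prv_assume; left.
  case: (R0p_id_cases Tp) => [np|->|[n ->]].
  + apply: Hyp; exists p => //.
    exact: (esym (trans_coincide id join_coincide' np)).
  + exact: AndE2 prv_join_cong.
  apply: prv_join_P => // G.
  by apply: AndE2; apply: AndE1; apply: prv_assume; left.
case=> p Tp ->; case: (R0p_id_cases Tp) => [np|->|[n ->]].
- apply: Hyp; left; exists p => //; exact: trans_coincide join_coincide np.
- exact: prv_cong_join.
- exact: prv_join_numeral.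
Qed.

End Join.

Theorem theorem5p12 (L : signature) (U V : theory L)
    (tau tau' : translation Lap L) :
  R0p_sourced_by tau U ->
  R0p_sourced_by tau' V ->
  coincide (restrict tau) (restrict tau') ->
  R0p_sourced (theory_union U V).
Proof.
move=> [ceU eU] [ceV eV] agree; exists (join tau tau'); split.
  exact: ce_theory_union.
(* The union of the two translated theories serves as the intermediate theory. *)
apply: deductively_equivalent_trans (join_equivalent agree).
exact: deductively_equivalent_union.
Qed.
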